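(* Let $A$ be a Prüfer $v$-multiplication domain which satisfies the following condition: for each finitely generated nonzero ideal $I$ of $A$, we have $I^n\subseteq bA\subseteq I_v$ for some $n\geq 1$ and some $b\in A$. Then $A$ is globally perinormal.
   Context: All rings are commutative unitary integral domains. An overring of a domain $A$ is a ring $B$ between $A$ and the quotient field $K$ of $A$. An overring $B$ of $A$ is a going down overring if going down holds for $A\subseteq B$, that is, for each $Q\in\mathrm{Spec}(B)$ the induced map $\mathrm{Spec}(B_Q)\to\mathrm{Spec}(A_{Q\cap A})$ is surjective. $A$ is globally perinormal if every going down overring of $A$ is a fraction ring of $A$, i.e. of the form $S^{-1}A$ for a multiplicative set $S\subseteq A\setminus\{0\}$. For a nonzero fractional ideal $H$ of $A$, put $H^{-1}=\{x\in K\mid xH\subseteq A\}$ and $H_v=(H^{-1})^{-1}$. $A$ is a Prüfer $v$-multiplication domain (PVMD) if for every finitely generated nonzero ideal $I$ of $A$ there exists a finitely generated nonzero ideal $J$ of $A$ such that $(IJ)_v$ is a principal ideal. *)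

(* Defs.v *)
From mathcomp Require Import all_boot all_order all_algebra.
From mathcomp Require Import all_classical.

Set Implicit Arguments.
Unset Strict Implicit.
Unset Printing Implicit Defensive.

Import GRing.Theory.
Local Open Scope classical_set_scope.
Local Open Scope ring_scope.

(* D and B are meant to be subrings of the ambient field K.  Localizations are
   again sets of elements of K, so the map Spec(B_Q) -> Spec(D_(Q :&: D)) is
   intersection with D_(Q :&: D). *)
Section Subrings.
Variable K : fieldType.
Implicit Types D B S P Q H I J : set K.

Definition overring D B : Prop :=
  GRing.subring_closed (mem B) /\ D `<=` B.

Definition ideal D I : Prop :=
  [/\ I `<=` D, I 0, (forall x y, I x -> I y -> I (x + y))
    & (forall a x, D a -> I x -> I (a * x))].

Definition prime_ideal D P : Prop :=
  [/\ ideal D P, ~ P 1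
    & forall x y, D x -> D y -> P (x * y) -> P x \/ P y].

Definition Spec D : set (set K) := [set P | prime_ideal D P].

Definition fraction_ring D S : set K := [set a / s | a in D & s in S].

Definition is_fraction_ring D B : Prop :=
  exists S, [/\ S `<=` D `\ 0, GRing.mulr_closed (mem S)
             & B = fraction_ring D S].

Definition localization D Q : set K := fraction_ring D (D `\` Q).

Definition going_down D B : Prop :=
  forall Q, Spec B Q ->
    set_surj (Spec (localization B Q)) (Spec (localization D (Q `&` D)))
             (fun P => P `&` localization D (Q `&` D)).

Definition generated D (n : nat) (g : 'I_n -> K) : set K :=
  [set x | exists c : 'I_n -> K,
     (forall i, D (c i)) /\ x = \sum_(i < n) c i * g i].

Definition nonzero_fg_ideal D I : Prop :=
  (exists (n : nat) (g : 'I_n -> K),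
     (forall i, D (g i)) /\ I = generated D g) /\ I <> [set 0].

Definition principal D (b : K) : set K := [set b * a | a in D].

Definition principal_ideal D I : Prop := exists2 b, D b & I = principal D b.

Definition ideal_mul I J : set K :=
  [set x | exists (n : nat) (a b : 'I_n -> K),
     [/\ (forall i, I (a i)), (forall i, J (b i))
       & x = \sum_(i < n) a i * b i]].

Definition ideal_exp D I (n : nat) : set K := iter n (ideal_mul I) D.

Definition ideal_inv D H : set K := [set x | forall y, H y -> D (x * y)].

Definition v_closure D H : set K := ideal_inv D (ideal_inv D H).

End Subrings.

Definition dom_set (A : idomainType) : set {fraction A} :=
  range (@FracField.tofrac A).
Arguments dom_set : clear implicits.

Definition globally_perinormal (A : idomainType) : Prop :=
  forall B : set {fraction A},
    overring (dom_set A) B -> going_down (dom_set A) B ->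
    is_fraction_ring (dom_set A) B.

Definition PVMD (A : idomainType) : Prop :=
  forall I : set {fraction A}, nonzero_fg_ideal (dom_set A) I ->
    exists2 J : set {fraction A}, nonzero_fg_ideal (dom_set A) J
      & principal_ideal (dom_set A) (v_closure (dom_set A) (ideal_mul I J)).

(* Main.v *)
Require Import Defs.
From mathcomp Require Import all_boot all_order all_algebra.
From mathcomp Require Import all_classical.

Import GRing.Theory.
Local Open Scope classical_set_scope.
Local Open Scope ring_scope.

(** Let B be a going down overring of A and x = a/c an element of B.  Choose J
    with ((a,c)J)_v = bA, so that H = (c/b)J satisfies H + xH = ((a,c)J)/b,
    whence (H + xH)^-1 = A.  The hypothesis on H gives d with H^n inside dA and
    d in H_v; since x is in H^-1, dx is in A.  It remains to see that d is a
    unit of B.  Otherwise d lies in a prime M of B; put P = M :&: A.  No s in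
    A \ P can send powers of all the generators of H + xH into dA, for then
    s/d would be in A.  Hence some prime Q of A_P contains d, therefore H, but
    misses x h for some generator h of H.  By going down, Q = N :&: A_P for a
    prime N of B_M, and x h is in N because h is and x is in B. *)

(** * Prime ideals, localization and going down for subrings of a field *)

Section PrimeIdeals.
Context {K : fieldType}.
Implicit Types (D B L P Q M : set K) (x y d g u : K).

Lemma subring_closed_setP D : GRing.subring_closed (mem D) <->
  [/\ D 1, forall x y, D x -> D y -> D (x - y)
    & forall x y, D x -> D y -> D (x * y)].
Proof.
split=> -[D1 Dsub Dmul].
  split=> [|x y Dx Dy|x y Dx Dy]; apply/set_mem => //.
    by apply: Dsub; apply/mem_set.
  by apply: Dmul; apply/mem_set.
by split=> [|x y|x y]; rewrite ?inE //; [apply: Dsub|apply: Dmul].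
Qed.

Lemma subring0 D : GRing.subring_closed (mem D) -> D 0.
Proof. by case/subring_closed_setP=> D1 Dsub _; rewrite -(subrr 1); exact: Dsub. Qed.

Lemma subringD D x y : GRing.subring_closed (mem D) -> D x -> D y -> D (x + y).
Proof.
move=> hD Dx Dy; have D0 := subring0 D hD.
case/subring_closed_setP: hD => _ Dsub _.
by rewrite -[y]opprK -[- y]sub0r; apply/Dsub/Dsub.
Qed.

Lemma subringX D x n : GRing.subring_closed (mem D) -> D x -> D (x ^+ n).
Proof.
case/subring_closed_setP=> D1 _ Dmul Dx.
by elim: n => [|n IHn]; rewrite ?expr0 // exprS; apply: Dmul.
Qed.

Lemma prime_idealX D P x n : prime_ideal D P -> GRing.subring_closed (mem D) ->
  D x -> P (x ^+ n) -> P x.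
Proof.
move=> [_ P1 Pmul] hD Dx; elim: n => [//|n IHn]; rewrite exprS.
by case/Pmul => //; apply: subringX.
Qed.

Lemma prime_ideal_contract D B M : overring D B -> GRing.subring_closed (mem D) ->
  prime_ideal B M -> prime_ideal D (M `&` D).
Proof.
move=> [_ DB] hD [[_ M0 Madd Mmul] M1 Mpr].
have [_ _ Dmul] := (subring_closed_setP D).1 hD.
split=> [|[//]|x y Dx Dy [Mxy _]].
  split=> [x []|||] //; first by split=> //; exact: subring0.
    by move=> x y [Mx Dx] [My Dy]; split; [exact: Madd | exact: subringD].
  by move=> a x Da [Mx Dx]; split; [apply: Mmul => //; exact: DB | exact: Dmul].
by case: (Mpr x y (DB x Dx) (DB y Dy) Mxy) => ?; [left|right].
Qed.

Lemma localization_sub D P : GRing.subring_closed (mem D) -> prime_ideal D P ->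
  D `<=` localization D P.
Proof.
move=> /subring_closed_setP[D1 _ _] [_ P1 _] x Dx.
by exists x => //; exists 1 => //; rewrite divr1.
Qed.

Lemma localization_subring D P : GRing.subring_closed (mem D) ->
  prime_ideal D P -> GRing.subring_closed (mem (localization D P)).
Proof.
move=> hD prP; have [D1 Dsub Dmul] := (subring_closed_setP D).1 hD.
have [[_ P0 _ _] _ Pmul] := prP.
have neq0 s : ~ P s -> s != 0 by move=> nPs; apply/eqP => s0; rewrite s0 in nPs.
have Smul s t : (D `\` P) s -> (D `\` P) t -> (D `\` P) (s * t).
  by move=> [Ds Ps] [Dt Pt]; split; [exact: Dmul | case/Pmul].
apply/subring_closed_setP; split.
- exact: (localization_sub D P).
- move=> _ _ [a Da [s Ss <-]] [b Db [t St <-]].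
  exists (a * t - b * s).
    by apply: Dsub; apply: Dmul => //; [case: St|case: Ss].
  exists (s * t); first exact: Smul.
  have := neq0 s Ss.2; have := neq0 t St.2 => t0 s0.
  by rewrite -[- (b / t)]mulNr addf_div // mulNr.
- move=> _ _ [a Da [s Ss <-]] [b Db [t St <-]].
  exists (a * b); first exact: Dmul.
  exists (s * t); first exact: Smul.
  by rewrite mulf_div.
Qed.

(* D (y / d) expresses that y belongs to the principal ideal dD. *)
Lemma exists_prime_avoiding_powers D d g : GRing.subring_closed (mem D) ->
    D d -> d != 0 -> (forall k, ~ D (g ^+ k / d)) ->
  exists Q, [/\ prime_ideal D Q, Q d & ~ Q g].
Proof.
move=> hD Dd d0 gd; have [D1 Dsub Dmul] := (subring_closed_setP D).1 hD.
have D0 := subring0 D hD.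
pose ok Q := [/\ ideal D Q, Q d & forall k, ~ Q (g ^+ k)].
(* The union of the empty chain is empty, hence not an ideal, so Zorn's lemma is applied to [ok]
   made vacuous on the empty set. *)
have [F /= Fok Ftot|Q [Qok Qmax]] :=
    @Zorn_bigcup K [set X | X !=set0 -> ok X].
  case=> z [Z FZ Zz].
  have F_ok X x : F X -> X x -> ok X by move=> FX Xx; apply: Fok => //; exists x.
  have [[ZD Z0 _ _] Zd _] := F_ok Z z FZ Zz.
  split; last 2 first.
  - by exists Z.
  - by move=> k [X FX Xg]; have [_ _ /(_ k)] := F_ok X _ FX Xg.
  split.
  - by move=> x [X FX Xx]; have [[XD _ _ _] _ _] := F_ok X x FX Xx; exact: XD.
  - by exists Z.
  - move=> x y [X FX Xx] [Y FY Yy].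
    have [[_ _ Xadd _] _ _] := F_ok X x FX Xx.
    have [[_ _ Yadd _] _ _] := F_ok Y y FY Yy.
    by case: (Ftot X Y FX FY) => sub; [exists Y | exists X] => //;
       [apply: Yadd | apply: Xadd] => //; exact: sub.
  - move=> a x Da [X FX Xx]; exists X => //.
    by have [[_ _ _ Xmul] _ _] := F_ok X x FX Xx; exact: Xmul.
have okd : ok [set y | D (y / d)].
  split=> //=; last by rewrite divff.
  split=> /=.
  - by move=> y Dy; rewrite -(divfK d0 y); exact: Dmul.
  - by rewrite mul0r.
  - by move=> x y Dx Dy; rewrite mulrDl; exact: subringD.
  - by move=> a x Da Dx; rewrite -mulrA; exact: Dmul.
(* The maximal set is nonempty, as otherwise the ideal dD would properly contain it. *)
have {}Qok : ok Q.
  apply: Qok; apply: contrapT => Q0; apply: (Qmax [set y | D (y / d)]) => //.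
  split=> [x Qx|sub]; first by case: Q0; exists x.
  by case: Q0; exists d; apply: sub; case: okd.
have [[QD Q0 Qadd Qmul] Qd Qg] := Qok.
(* The ideal Q + xD properly contains Q, so by maximality it contains a power of g. *)
have hits x : D x -> ~ Q x ->
    exists k q a, [/\ Q q, D a & g ^+ k = q + a * x].
  move=> Dx nQx; apply: contrapT => hno.
  apply: (Qmax [set z | exists q a, [/\ Q q, D a & z = q + a * x]]).
    split=> [q Qq|sub]; first by exists q, 0; rewrite mul0r addr0.
    by apply: nQx; apply: sub; exists 0, 1; rewrite mul1r add0r.
  move=> _; split; last 2 first.
  - by exists d, 0; rewrite mul0r addr0.
  - by move=> k [q [a [Qq Da E]]]; apply: hno; exists k, q, a.
  split.
  - move=> _ [q [a [Qq Da ->]]].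
    by apply: subringD => //; [exact: QD | exact: Dmul].
  - by exists 0, 0; rewrite mul0r addr0.
  - move=> _ _ [q [a [Qq Da ->]]] [r [b [Qr Db ->]]].
    exists (q + r), (a + b); split; [exact: Qadd | exact: subringD|].
    by rewrite mulrDl addrACA.
  - move=> c _ Dc [q [a [Qq Da ->]]].
    exists (c * q), (c * a); split; [exact: Qmul | exact: Dmul|].
    by rewrite mulrDr mulrA.
exists Q; split=> //; last by move: (Qg 1%N); rewrite expr1.
split=> //; first by move: (Qg 0%N); rewrite expr0.
move=> x y Dx Dy Qxy; apply: contrapT => /not_orP[nQx nQy].
have [k [q [a [Qq Da Ek]]]] := hits x Dx nQx.
have [l [r [b [Qr Db El]]]] := hits y Dy nQy.
(* Multiplying q + ax by r + by puts a power of g in Q, since q, r and xy lie in Q. *)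
apply: (Qg (k + l)%N).
have -> : g ^+ (k + l) = (r + b * y) * q + ((a * x) * r + (a * b) * (x * y)).
  by rewrite exprD Ek El mulrDl [q * _]mulrC [a * x * _]mulrDr
    [a * x * (b * y)]mulrACA.
apply: (Qadd); first by apply: Qmul => //; apply: subringD => //;
  [exact: QD | exact: Dmul].
by apply: Qadd; apply: Qmul => //; exact: Dmul.
Qed.

(* Induction on the sum of the exponents, multiplying u by one g i at a time. *)
Lemma inverse_trivial_powers D (I : finType) (g : I -> K) :
    GRing.subring_closed (mem D) -> (forall i, D (g i)) ->
    (forall u, (forall i, D (u * g i)) -> D u) ->
  forall (k : I -> nat) u, (forall i, D (u * g i ^+ k i)) -> D u.
Proof.
move=> hD Dg invD k; have [n le_n] := ubnP (\sum_i k i)%N.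
elim: n => // n IHn in k le_n *.
move=> u Du; have [/existsP[i /eqP ki0]|/existsPn kpos] := boolP [exists i, k i == 0%N].
  by have := Du i; rewrite ki0 expr0 mulr1.
apply: invD => i.
(* [u * g i] satisfies the hypothesis for [k']: at [i] the factor makes up for the lowered exponent,
   elsewhere it is a multiplier from [D]. *)
pose k' j := (if j == i then (k j).-1 else k j)%N.
have ki : k i = (k' i).+1 by rewrite /k' eqxx prednK // lt0n kpos.
have k'E j : j != i -> k' j = k j by rewrite /k' => /negPf->.
apply: (IHn k') => [|j].
  rewrite -ltnS; apply: leq_trans le_n; rewrite ltnS.
  by rewrite (bigD1 i) //= [leqRHS](bigD1 i) //= ki (eq_bigr _ k'E).
have [->|ji] := eqVneq j i; first by rewrite -mulrA -exprS -ki.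
rewrite k'E // mulrAC; have [_ _ Dmul] := (subring_closed_setP D).1 hD.
exact: Dmul.
Qed.

(** This isolates the use of going down from the v-operation. With H the ideal generated by the
    [h i], [invD] says that (H + xH)^-1 lies in D, and the last hypothesis puts H in the radical of
    dD. *)
Lemma going_down_unit D B (T : finType) (h : T -> K) x d :
    GRing.subring_closed (mem D) -> overring D B -> going_down D B ->
    B x -> D d -> d != 0 ->
    (forall i, D (h i)) -> (forall i, D (x * h i)) ->
    (forall u, (forall i, D (u * h i)) -> (forall i, D (u * (x * h i))) -> D u) ->
    (forall i, exists n, D (h i ^+ n / d)) ->
  B d^-1.
Proof.
move=> hD hB gd Bx Dd d0 Dh Dxh invD hpow; apply: contrapT => nBd.
have [D1 Dsub Dmul] := (subring_closed_setP D).1 hD.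
have [hBr DB] := hB.
(* The avoidance lemma for g = 1: no power of 1 lies in dB, as d is not a unit of B. *)
have [M [prM Md _]] : exists M, [/\ prime_ideal B M, M d & ~ M 1].
  apply: exists_prime_avoiding_powers => //; first exact: DB.
  by move=> k; rewrite expr1n div1r.
have prP := prime_ideal_contract D B M hB hD prM.
set P := M `&` D in prP; have Pd : P d by [].
have [[_ P0 _ Pmul] P1 Ppr] := prP.
pose L := localization D P.
have hL : GRing.subring_closed (mem L) by exact: localization_subring.
have DL : D `<=` L by exact: localization_sub.
have [i Li] : exists i, forall k, ~ L ((x * h i) ^+ k / d).
  apply: contrapT => /forallNP no_i.
  (* If some power of x h i lies in dL, a denominator [ks.2] outside P carries that power into
     dD. *)
  have /choice[ks hks] i : exists ks : nat * K,
      (D `\` P) ks.2 /\ D (ks.2 / d * (x * h i) ^+ ks.1).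
    have /existsNP[k /contrapT[a Da [s Ss E]]] := no_i i.
    exists (k, s); split=> //=; rewrite mulrAC -mulrA -E mulrC divfK //.
    by apply/eqP => s0; case: Ss; rewrite s0.
  have /choice[n hn] := hpow.
  (* A common denominator, outside P by primality; s in dD would contradict this because d is in
     P. *)
  pose s := \prod_i (ks i).2.
  have Dprod (p : pred T) : D (\prod_(i | p i) (ks i).2).
    by elim/big_rec: _ => // i y _ Dy; apply: (Dmul) => //; case: (hks i) => -[].
  have nPs : ~ P s.
    suff [] : D s /\ ~ P s by [].
    rewrite /s; elim/big_rec: _ => [|i y _ [Dy nPy]]; first by [].
    have [[Dk nPk] _] := hks i; split; first exact: Dmul.
    by case/Ppr.
  apply: nPs; suff Dsd : D (s / d).
    by rewrite -(divfK d0 s); exact: Pmul.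
  (* The sum type indexes the generators of H + xH: the left copy those of H, the right copy those
     of xH. *)
  pose g (j : T + T) := match j with inl i => h i | inr i => x * h i end.
  pose k (j : T + T) := match j with inl i => n i | inr i => (ks i).1 end.
  apply: (inverse_trivial_powers D _ g hD _ _ k).
  - by case.
  - by move=> u Du; apply: invD => i; [exact: (Du (inl i)) | exact: (Du (inr i))].
  - case=> i /=; first by rewrite mulrAC -mulrA; apply: Dmul; [exact: Dprod | exact: hn].
    rewrite /s (bigD1 i) //= [_ * \prod_(_ | _) _]mulrC -!mulrA.
    apply: Dmul; first exact: Dprod.
    by rewrite mulrA; case: (hks i).
have [Q [prQ Qd nQ]] :=
  exists_prime_avoiding_powers L d (x * h i) hL (DL d Dd) d0 Li.
(* [L] is the localization of D at the contraction of M, so going down at M yields a prime N of the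
   localization of B with trace Q on [L]. *)
have [N prN NQ] := gd M prM Q prQ.
have [[_ _ _ Nmul] _ _] := (prN : prime_ideal _ _).
have [[_ _ _ Qmul] _ _] := prQ.
(* A power of h i lies in dD, hence in the prime Q. *)
have Qh : Q (h i).
  have [n hn] := hpow i; apply: (prime_idealX L Q (h i) n) => //; first exact: DL.
  by rewrite -(divfK d0 (h i ^+ n)); apply: Qmul => //; exact: DL.
apply: nQ; rewrite -NQ; split; last exact: DL.
apply: Nmul; last by move: Qh; rewrite -NQ => -[].
exact: (localization_sub B M hBr prM).
Qed.
End PrimeIdeals.

(** * Finitely generated ideals, their products and inverses *)

Section FinitelyGenerated.
Context {K : fieldType}.
Implicit Types (D I J : set K) (u : K) (n : nat).

Lemma mem_generated D n (g : 'I_n -> K) i : GRing.subring_closed (mem D) ->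
  generated D g (g i).
Proof.
move=> hD; exists (fun j => (j == i)%:R); split.
  by move=> j; case: (j == i); [case/subring_closed_setP: hD | exact: subring0].
rewrite (bigD1 i) //= eqxx mul1r big1 ?addr0 // => j /negPf->.
by rewrite mul0r.
Qed.

Lemma generated_neq0 D n (g : 'I_n -> K) : GRing.subring_closed (mem D) ->
  generated D g <> [set 0] <-> exists i, g i != 0.
Proof.
move=> hD; split=> [nz|[i gi0] E]; last first.
  by move: gi0 (mem_generated D n g i hD); rewrite E /= => /eqP.
apply: contrapT => /forallNP g0; apply: nz.
have {}g0 i : g i = 0 by apply/eqP; move: (g0 i) => /negP; rewrite negbK.
apply/seteqP; split=> [x [c [_ ->]]|_ ->] /=.
  by apply: big1 => i _; rewrite g0 mulr0.
exists (fun=> 0); split=> [_|]; first exact: subring0.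
by rewrite big1 // => i _; rewrite mul0r.
Qed.

Lemma mem_ideal_mul I J (x y : K) : I x -> J y -> ideal_mul I J (x * y).
Proof.
move=> Ix Jy; exists 1%N, (fun=> x), (fun=> y).
by rewrite big_ord_recl big_ord0 addr0.
Qed.

Lemma mem_ideal_exp D I (x : K) n : D 1 -> I x -> ideal_exp D I n (x ^+ n).
Proof.
by move=> D1 Ix; elim: n => [|n IHn] //=; rewrite exprS; exact: mem_ideal_mul.
Qed.

Lemma mem_inv_generated D n (g : 'I_n -> K) x : GRing.subring_closed (mem D) ->
  (forall i, D (x * g i)) -> ideal_inv D (generated D g) x.
Proof.
move=> hD Dxg _ [c [Dc ->]].
have [_ _ Dmul] := (subring_closed_setP D).1 hD.
rewrite mulr_sumr; elim/big_rec: _ => [|i y _ Dy]; first exact: subring0.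
by apply: subringD => //; rewrite mulrCA; exact: Dmul.
Qed.

Lemma mem_inv_ideal_mul D I J u : GRing.subring_closed (mem D) ->
  (forall y z, I y -> J z -> D (u * (y * z))) -> ideal_inv D (ideal_mul I J) u.
Proof.
move=> hD Du _ [n [y [z [Iy Jz ->]]]].
rewrite mulr_sumr; elim/big_rec: _ => [|i w _ Dw]; first exact: subring0.
by apply: subringD => //; exact: Du.
Qed.

Lemma principal_divP D (b y : K) : b != 0 -> principal D b y <-> D (y / b).
Proof.
move=> b0; split=> [[a Da <-]|Dyb]; first by rewrite mulrC mulKf.
by exists (y / b) => //; rewrite mulrC divfK.
Qed.

Lemma sub_v_closure D I : I `<=` v_closure D I.
Proof. by move=> x Ix y hy; rewrite mulrC; exact: hy. Qed.
End FinitelyGenerated.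


(** * Global perinormality *)

(** Working with a subring D of a field whose elements are all quotients of elements of D frees the
    argument from the construction of the fraction field. *)
Lemma PVMD_cond_globally_perinormal (K : fieldType) (D : set K) :
    GRing.subring_closed (mem D) ->
    (forall x : K, exists a c, [/\ D a, D c, c != 0 & x = a / c]) ->
    (forall I, nonzero_fg_ideal D I -> exists2 J, nonzero_fg_ideal D J
       & principal_ideal D (v_closure D (ideal_mul I J))) ->
    (forall I, nonzero_fg_ideal D I -> exists n b,
       [/\ (1 <= n)%N, D b, ideal_exp D I n `<=` principal D b
         & principal D b `<=` v_closure D I]) ->
  forall B, overring D B -> going_down D B -> is_fraction_ring D B.
Proof.
move=> hD fracD pvmd cond B hB gd.
have [D1 Dsub Dmul] := (subring_closed_setP D).1 hD.
have [hBr DB] := hB; have [B1 Bsub Bmul] := (subring_closed_setP B).1 hBr.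
(* All nonzero elements of D that become units in B; only the inclusion of B in the fraction ring
   then needs an argument. *)
exists [set s | [/\ D s, s != 0 & B s^-1]]; split.
- by move=> s [Ds /eqP s0 _].
- split=> [|s t]; rewrite !inE /=; first by rewrite invr1 oner_neq0.
  move=> [Ds s0 Bs] [Dt t0 Bt]; rewrite mulf_neq0 // invfM.
  by split=> //; [exact: Dmul | exact: Bmul].
apply/seteqP; split=> [x Bx|_ [a Da [s [_ _ Bs] <-]]]; last first.
  by apply: Bmul => //; exact: DB.
suff [d [Dd d0 Ddx Bd]] : exists d, [/\ D d, d != 0, D (d * x) & B d^-1].
  by exists (d * x) => //; exists d => //; rewrite mulrC mulKf.
have [a [c [Da Dc c0 xE]]] := fracD x.
pose g (i : 'I_2) := if i == ord0 then a else c.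
have Ig i : generated D g (g i) by exact: mem_generated.
have [|J [[m [j [Dj ->]]] /(generated_neq0 D m j hD)[i0 ji0]] [b Db vE]] :=
    pvmd (generated D g).
  split; first by exists 2%N, g; split=> // i; rewrite /g; case: ifP.
  by apply/generated_neq0 => //; exists ord_max.
set IJ := ideal_mul _ _ in vE.
have IJg i k : IJ (g i * j k) by apply: mem_ideal_mul => //; exact: mem_generated.
have IJb y : IJ y -> principal D b y by rewrite -vE; exact: sub_v_closure.
(* The nonzero product of c and [j i0] lies in bD; [ord_max] is the index of c. *)
have b0 : b != 0.
  apply/eqP => b0; have [y _ /esym/eqP] := IJb _ (IJg ord_max i0).
  by rewrite b0 mul0r mulf_eq0 (negPf c0) (negPf ji0).
pose h k := c * j k / b.
have Dh k : D (h k).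
  by apply/(principal_divP D b) => //; apply/IJb/(IJg ord_max).
have xh k : x * h k = a * j k / b.
  by rewrite /h xE -[c * _ / b]mulrA mulrA divfK // mulrA.
have Dxh k : D (x * h k).
  by rewrite xh; apply/(principal_divP D b) => //; apply/IJb/(IJg ord0).
(* As b lies in (IJ)_v, it suffices that u/b lies in (IJ)^-1. On the products of generators a j k
   and c j k this is the hypothesis on u. *)
have invD u : (forall k, D (u * h k)) -> (forall k, D (u * (x * h k))) -> D u.
  move=> Duh Duxh.
  have : v_closure D IJ b by rewrite vE; exists 1 => //; rewrite mulr1.
  move=> /(_ (u / b)); rewrite [b * _]mulrC divfK //; apply.
  apply: mem_inv_ideal_mul => // y z Iy Jz; rewrite mulrA.
  move: z Jz; apply: mem_inv_generated => // k; rewrite mulrAC.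
  move: y Iy; apply: mem_inv_generated => // i.
  rewrite -[_ * g i]mulrA mulrAC [j k * _]mulrC -mulrA.
  by rewrite /g; case: ifP => _; [rewrite -xh; exact: Duxh | exact: Duh].
have h0 : h i0 != 0 by rewrite !mulf_neq0 // invr_eq0.
have [|n [d [_ Dd Hd dH]]] := cond (generated D h).
  by split; [exists m, h | apply/generated_neq0 => //; exists i0].
(* The nonzero n-th power of [h i0] lies in dD. *)
have d0 : d != 0.
  apply/eqP => d0; have := Hd _ (mem_ideal_exp D _ _ n D1 (mem_generated D m h i0 hD)).
  by case=> y _ /esym/eqP; rewrite d0 mul0r expf_eq0 (negPf h0) andbF.
exists d; split=> //.
  (* Here d is in H_v and x is in H^-1. *)
  apply: dH; first by exists 1 => //; rewrite mulr1.
  exact: mem_inv_generated.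
apply: (going_down_unit D B _ h x d) => // k.
exists n; apply/(principal_divP D d) => //; apply: Hd.
by apply: mem_ideal_exp => //; exact: mem_generated.
Qed.

(** * Specialization to an integral domain inside its fraction field *)

Theorem theorem15 (A : idomainType) (A_PVMD : PVMD A)
    (A_cond : forall I : set {fraction A}, nonzero_fg_ideal (dom_set A) I ->
       exists (n : nat) (b : {fraction A}),
         [/\ (1 <= n)%N, dom_set A b,
             ideal_exp (dom_set A) I n `<=` principal (dom_set A) b
           & principal (dom_set A) b `<=` v_closure (dom_set A) I]) :
  globally_perinormal A.
Proof.
move=> B; apply: PVMD_cond_globally_perinormal => //.
  apply/subring_closed_setP; split; first by exists 1 => //; rewrite rmorph1.
    by move=> _ _ [x _ <-] [y _ <-]; exists (x - y) => //; rewrite rmorphB.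
  by move=> _ _ [x _ <-] [y _ <-]; exists (x * y) => //; rewrite rmorphM.
(* An element of the fraction field is the class of a pair [r], hence the quotient of its numerator
   by its denominator. *)
elim/quotW=> r.
exists (FracField.tofrac \n_r), (FracField.tofrac \d_r).
have d0 : FracField.tofrac \d_r != 0 :> {fraction A}.
  by rewrite tofrac_eq0 denom_ratioP.
split=> //; [by exists \n_r | by exists \d_r |].
apply: (mulIf d0); rewrite divfK // {d0}.
unlock FracField.tofrac; rewrite -[LHS]FracField.pi_mul.
apply/eqmodP; rewrite /= FracField.equivfE /FracField.mulf.
by rewrite !numden_Ratio ?mulf_neq0 ?oner_neq0 ?denom_ratioP // !mulr1 mulrC.
Qed.
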